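(* Let $q=p^{2a}$ where $p$ is an odd prime and $a>0$ is an odd integer. Suppose $p$ and $r$ satisfy one of: (1) $r\in\{3,7\}$ and $p\equiv 5$ or $7\pmod 8$; (2) $r=9$ and $p\equiv -1\pmod 5$. Then for all integers $t,\ell$ with $1\le t\le\ell\le\big\lfloor\frac{q+4\sqrt{q}-2r-3}{r+1}\big\rfloor$ there exists a $q$-ary linear locally repairable code with locality $r$ and parameters $$[\,n=\ell(r+1),\ k=rt-(r-1),\ d\ge n-(t-1)(r+1)-1\,]_q$$ whose Singleton-optimal defect is at most $1$.
   Context: A code $\mathcal{C}\subseteq\mathbb{F}_q^n$ has locality $r$ if for every coordinate $i$ there is a set $I_i\subseteq\{1,\dots,n\}\setminus\{i\}$ with $|I_i|=r$ such that for $a\ne a'$ in $\mathbb{F}_q$ the restrictions to $I_i$ of $\{c\in\mathcal{C}:c_i=a\}$ and $\{c\in\mathcal{C}:c_i=a'\}$ are disjoint. For an $[n,k,d]_q$ code with locality $r$ the Singleton-optimal defect is $\Delta=n-k-\lceil k/r\rceil+2-d\ge 0$; optimal means $\Delta=0$, almost optimal means $\Delta=1$. *)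

(* Defs.v *)
From HB Require Import structures.
From mathcomp Require Import all_boot all_order all_algebra.
Set Implicit Arguments. Unset Strict Implicit. Unset Printing Implicit Defensive.
Import GRing.Theory Num.Theory.

Definition wt (F : finFieldType) (n : nat) (c : 'rV[F]_n) : nat :=
  #|[set i : 'I_n | c ord0 i != 0%R]|.

(* Minimum distance of a linear code: least weight of a nonzero codeword
   (n if the code is {0}; irrelevant here since k >= 1). *)
Definition min_dist (F : finFieldType) (n : nat) (C : {vspace 'rV[F]_n}) : nat :=
  \big[minn/n]_(c : 'rV[F]_n | (c \in C) && (c != 0%R)) wt c.

(* Locality r, exactly as in the paper: for each coordinate i there is a
   recovery set I_i not containing i, of size r, such that the restrictions to
   I_i of codewords with different values at i are disjoint, i.e. two codewords
   differing at i differ somewhere on I_i. *)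
Definition has_locality (F : finFieldType) (n : nat) (C : {vspace 'rV[F]_n})
    (r : nat) : Prop :=
  forall i : 'I_n, exists I : {set 'I_n},
    [/\ i \notin I, #|I| = r &
        forall c c' : 'rV[F]_n, c \in C -> c' \in C -> c ord0 i != c' ord0 i ->
          exists2 j, j \in I & c ord0 j != c' ord0 j].

Definition ceil_div (k r : nat) : nat := (k + r.-1) %/ r.

Definition lrc_defect (n k d r : nat) : int :=
  (n%:Z - k%:Z - (ceil_div k r)%:Z + 2 - d%:Z)%R.

(* Main.v *)
Require Import Defs.
From HB Require Import structures.
From mathcomp Require Import all_boot all_order all_algebra.
From mathcomp Require Import cyclic finfield.
From mathcomp Require Import zify ring.
Import GRing.Theory Num.Theory.
Set Implicit Arguments.
Unset Strict Implicit.
Unset Printing Implicit Defensive.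

(** Write s = p^a, so that q = s^2, and r + 1 = 2h. The codes are evaluation
    codes on the genus 2 curves y^2 = x^5 + x (h = 2, 4) and y^2 = 1 - x^5
    (h = 5). If xi is a primitive 2h-th root of unity, then
    (x, y) |-> (xi^2 x, xi^5 y) is an automorphism of order 2h; its orbits off
    the branch points are the repair groups. The functions evaluated are the
    A(x) + y B(x) with poles only at infinity, of order at most 2h(t-1) + 1,
    such that no monomial x^e y with h | e + 1 occurs in B. The missing
    monomials provide the parity check of an orbit, and the bound on the pole
    order bounds the number of zeros.

    The length comes from the curves being maximal over F_q, which is proved by
    elementary counts. For s = -1 modulo 8 or 10, write 1 = u + v and count by
    the classes of u and v modulo F_s^*. For s = 5 modulo 8 one uses that
    u |-> u(1+u)^(s-1) is almost a bijection of F_q: its inverse is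
    c |-> c(1-c)^(s-1) off the group of norm 1 elements, and every u != -1
    of norm 1 is sent to 1. *)

(** * Roots of unity and power maps in a finite field *)

Section FiniteFieldCounting.
Local Open Scope ring_scope.
Variable F : finFieldType.
Implicit Types (x y z : F) (d n : nat) (S : {set F}).

Definition unity_roots d : {set F} := [set x | x ^+ d == 1].

Lemma one_unity_roots d : 1 \in unity_roots d.
Proof. by rewrite inE expr1n. Qed.

Lemma unity_roots_dvd d n : (d %| n)%N -> unity_roots d \subset unity_roots n.
Proof.
case/dvdnP=> k ->; apply/subsetP=> x; rewrite !inE => /eqP xd.
by rewrite mulnC exprM xd expr1n.
Qed.

Lemma predn_card_gt0 : (0 < #|F|.-1)%N.
Proof. by rewrite -subn1 subn_gt0 finNzRing_gt1. Qed.

Lemma expf_predn_card x : x != 0 -> x ^+ #|F|.-1 = 1.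
Proof.
move=> x0; apply: (mulfI x0); rewrite -exprS mulr1.
by rewrite prednK ?expf_card // ltnW ?finNzRing_gt1.
Qed.

Lemma finField_prim_root : {g : F | #|F|.-1.-primitive_root g}.
Proof.
have /hasP/sig2W[g _ hg] : has #|F|.-1.-primitive_root (enum [set x : F | x != 0]).
  apply: has_prim_root; first exact: predn_card_gt0.
  - apply/allP=> x; rewrite mem_enum inE => x0.
    by rewrite unity_rootE expf_predn_card.
  - exact: enum_uniq.
  - by rewrite -cardE (_ : [set x | x != 0] = ~: [set 0]) ?cardsC1 //;
      apply/setP=> x; rewrite !inE.
by exists g.
Qed.

Lemma finField_prim_root_dvd d : (d %| #|F|.-1)%N -> {g : F | d.-primitive_root g}.
Proof.
have [g hg] := finField_prim_root => dF.
by exists (g ^+ (#|F|.-1 %/ d)); apply: dvdn_prim_root.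
Qed.

Lemma card_unity_roots_le d : (0 < d)%N -> (#|unity_roots d| <= d)%N.
Proof.
move=> d0; rewrite cardE; apply: max_unity_roots (enum_uniq _) => //.
by apply/allP=> x; rewrite mem_enum inE unity_rootE.
Qed.

Lemma card_unity_roots d : (d %| #|F|.-1)%N -> #|unity_roots d| = d.
Proof.
move=> dF; have d0 : (0 < d)%N by apply: dvdn_gt0 dF; exact: predn_card_gt0.
apply/eqP; rewrite eqn_leq card_unity_roots_le //=.
have [g hg] := finField_prim_root_dvd dF.
rewrite -[X in (X <= _)%N]card_ord -(card_imset (f := fun i : 'I_d => g ^+ i)).
  apply: subset_leq_card; apply/subsetP=> _ /imsetP[i _ ->].
  by rewrite inE -exprM mulnC exprM (prim_expr_order hg) expr1n.
move=> i j /eqP; rewrite (eq_prim_root_expr hg) !modn_small // => /eqP.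
exact: val_inj.
Qed.

Lemma exists_expr_root d x : (d %| #|F|.-1)%N ->
  x \in unity_roots (#|F|.-1 %/ d) -> exists y, y ^+ d = x.
Proof.
move=> dF; rewrite inE => /eqP xd.
have d0 : (0 < d)%N by apply: dvdn_gt0 dF; exact: predn_card_gt0.
have [g hg] := finField_prim_root.
have xF : x ^+ #|F|.-1 = 1 by rewrite -(divnK dF) exprM xd expr1n.
have [i xi] := prim_rootP hg xF.
move/eqP: xd; rewrite xi -exprM -(prim_order_dvd hg) -{1}(divnK dF) mulnC.
rewrite dvdn_pmul2r; last by rewrite divn_gt0 // dvdn_leq // predn_card_gt0.
by case/dvdnP=> k ->; exists (g ^+ k); rewrite -exprM.
Qed.

(** By cyclicity every z in [S] has a d-th root y, and the fibre over z is then the coset of y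
    modulo the d-th roots of unity. *)
Lemma card_preim_expr d S : (d %| #|F|.-1)%N ->
  S \subset unity_roots (#|F|.-1 %/ d) ->
  #|[set x | x ^+ d \in S]| = (d * #|S|)%N.
Proof.
move=> dF /subsetP SF.
rewrite -sum1dep_card (partition_big (fun x => x ^+ d) (mem S)) //=.
rewrite mulnC -sum_nat_const; apply: eq_bigr => z zS.
have d0 : (0 < d)%N by apply: dvdn_gt0 dF; exact: predn_card_gt0.
have [y yd] := exists_expr_root dF (SF z zS).
have y0 : y != 0.
  apply: contraTneq (SF z zS) => y0.
  rewrite -yd y0 expr0n gtn_eqF // inE expr0n gtn_eqF ?[0 == 1]eq_sym ?oner_eq0 //.
  by rewrite divn_gt0 // dvdn_leq // predn_card_gt0.
rewrite sum1dep_card; transitivity #|[set y * u | u in unity_roots d]|; last first.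
  by rewrite card_imset ?card_unity_roots //; apply: mulfI.
apply: eq_card => x; rewrite inE; apply/andP/imsetP.
  case=> _ /eqP xz; exists (x / y); last by rewrite mulrC divfK.
  by rewrite inE expr_div_n xz yd divff // -yd expf_neq0.
case=> u; rewrite inE => /eqP ud ->.
by rewrite exprMn ud mulr1 yd.
Qed.

(** A nonzero fibre of the power map lies in one coset of the d-th roots of unity. This later bounds
    the number of orbits from below, each orbit being labelled by the value of x^h. *)
Lemma card_le_imset_expr d S : (0 < d)%N -> 0 \notin S ->
  (#|S| <= d * #|[set x ^+ d | x in S]|)%N.
Proof.
move=> d0 S0; rewrite -sum1_card.
rewrite (partition_big (fun x => x ^+ d) (mem [set x ^+ d | x in S])) /=; last first.
  by move=> x xS; apply: imset_f.
rewrite mulnC -sum_nat_const; apply: leq_sum => _ /imsetP[y yS ->].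
have y0 : y != 0 by apply: contraNneq S0 => <-.
rewrite sum1dep_card; apply: leq_trans (card_unity_roots_le d0).
rewrite -(card_imset (mem (unity_roots d)) (mulfI y0)); apply: subset_leq_card.
apply/subsetP=> x; rewrite inE => /andP[_ /eqP xy].
apply/imsetP; exists (x / y); last by rewrite mulrC divfK.
by rewrite inE expr_div_n xy divff // expf_neq0.
Qed.

(* The map A |-> (A^(s-1), (1-A)^(s-1)) is a bijection from the complement of
   the subfield of s elements to the pairs of distinct elements other than 1
   of the group of norm 1 elements. *)
Lemma card_ge_norm_one_pairs (s : nat) (E : {set F * F}) (S : {set F}) :
  #|F| = (s ^ 2)%N -> (1 < s)%N -> [pchar F].-nat s ->
  (forall u v, (u, v) \in E ->
    [/\ u \in unity_roots s.+1, v \in unity_roots s.+1, u != 1, v != 1 & u != v]) ->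
  (forall A : F, A != 0 -> A != 1 ->
    ((A ^+ s.-1, (1 - A) ^+ s.-1) \in E) ||
      ((A ^+ s.-1 == 1) && ((1 - A) ^+ s.-1 == 1)) -> A \in S) ->
  (#|E| + s.-2 <= #|S|)%N.
Proof.
move=> Fs s1 sF EP SP.
(* If A^(s-1) = u and (1-A)^(s-1) = v, then 1 - uA = (1-A)^s = v(1-A); solving this linear equation
   for A gives [par]. *)
pose par (w : F * F) := (w.2 - 1) / (w.2 - w.1).
have frobB x y : (x - y) ^+ s = x ^+ s - y ^+ s.
  by rewrite exprDn_pchar // exprNn_pchar.
have parP u v : (u, v) \in E -> [/\ par (u, v) != 0, par (u, v) != 1,
    par (u, v) ^+ s.-1 = u & (1 - par (u, v)) ^+ s.-1 = v].
  case/EP; rewrite !inE => /eqP us /eqP vs u1 v1 uv.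
  have vu0 : v - u != 0 by rewrite subr_eq0 eq_sym.
  have v10 : v - 1 != 0 by rewrite subr_eq0.
  have u10 : 1 - u != 0 by rewrite subr_eq0 eq_sym.
  have u0 : u != 0.
    by apply/eqP=> u0; move/eqP: us; rewrite u0 exprS mul0r eq_sym oner_eq0.
  have v0 : v != 0.
    by apply/eqP=> v0; move/eqP: vs; rewrite v0 exprS mul0r eq_sym oner_eq0.
  have us' : u ^+ s = u^-1 by apply: (mulfI u0); rewrite -exprS us divff.
  have vs' : v ^+ s = v^-1 by apply: (mulfI v0); rewrite -exprS vs divff.
  have par1 : 1 - par (u, v) = (1 - u) / (v - u) by rewrite /par /=; field.
  have sE x : x ^+ s = x * x ^+ s.-1 by rewrite -exprS prednK // ltnW.
  have nz1 : par (u, v) != 0 by rewrite mulf_neq0 // invr_neq0.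
  have nz2 : 1 - par (u, v) != 0 by rewrite par1 mulf_neq0 // invr_neq0.
  split=> //; first by rewrite eq_sym -subr_eq0.
    apply: (mulfI nz1); rewrite -sE /par /= expr_div_n !frobB us' vs' expr1n.
    by field; rewrite u0 v0 vu0 mulN1r subr_eq0.
  apply: (mulfI nz2); rewrite -sE par1 /= expr_div_n !frobB us' vs' expr1n.
  by field; rewrite u0 v0 vu0 mulN1r subr_eq0.
have inj_par : {in E &, injective par}.
  move=> [u v] [u' v'] /parP[_ _ h1 h2] /parP[_ _ h1' h2'] e.
  have -> : u = u' by rewrite -[LHS]h1 e h1'.
  by have -> : v = v' by rewrite -[LHS]h2 e h2'.
have Fs1 : #|F|.-1 = (s.-1 * s.+1)%N by rewrite Fs; nia.
(* The elements other than 0 and 1 of the subfield of order s. Their pair is (1, 1), so they are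
   disjoint from the image of [par]. *)
have cK : #|unity_roots s.-1 :\ 1| = s.-2.
  have := cardsD1 1 (unity_roots s.-1).
  rewrite one_unity_roots card_unity_roots ?Fs1 ?dvdn_mulr //.
  by move/(congr1 predn) => e; rewrite [RHS]e.
rewrite -(card_in_imset inj_par) -cK -cardsUI.
rewrite (_ : _ :&: _ = set0) ?cards0 ?addn0; last first.
  apply/setP=> A; rewrite !inE; apply/negbTE/negP.
  case/and3P=> /imsetP[[u v] uvE ->] _.
  have [_ _ -> _] := parP _ _ uvE.
  by have [_ _ u1] := EP _ _ uvE; rewrite (negbTE u1).
apply: subset_leq_card; apply/subsetP=> A; rewrite !inE.
case/orP=> [/imsetP[[u v] uvE ->]|/andP[A1 /eqP As]].
  by have [n0 n1 eu ev] := parP _ _ uvE; apply: SP; rewrite // eu ev uvE.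
have s0 : (0 < s.-1)%N by lia.
have A0 : A != 0.
  by apply/eqP=> A0; move/eqP: As; rewrite A0 expr0n eqn0Ngt s0 /= eq_sym oner_eq0.
apply: SP => //; apply/orP; right; rewrite As eqxx /=.
have n2 : 1 - A != 0 by rewrite subr_eq0 eq_sym.
apply/eqP/(mulfI n2); rewrite mulr1 -exprS prednK ?frobB 1?ltnW // expr1n.
by rewrite -{1}(@prednK s) 1?ltnW // exprS As mulr1.
Qed.

End FiniteFieldCounting.

(** * Point counts on y^2 = 1 - x^5 and y^2 = x^5 + x *)

Section CurvePoints.
Local Open Scope ring_scope.
Variable F : finFieldType.

(** Each such x carries two points in odd characteristic. Excluding x = 0 and y = 0 leaves the
    points whose orbit under the automorphism has full length. *)
Definition curve_abscissae (f : {poly F}) : {set F} :=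
  [set x | [&& x != 0, f.[x] != 0 & [exists y, y ^+ 2 == f.[x]]]].

Variable s : nat.
Hypothesis cardF : #|F| = (s ^ 2)%N.
Hypothesis charF : [pchar F].-nat s.
Hypothesis s_gt1 : (1 < s)%N.

Let predn_cardF : #|F|.-1 = (s.-1 * s.+1)%N.
Proof. by rewrite cardF; nia. Qed.

Lemma exists_sqrt (M : nat) (x : F) : #|F|.-1 = (2 * M)%N -> x ^+ M = 1 ->
  [exists y, y ^+ 2 == x].
Proof.
move=> FM xM; have [||y yx] := @exists_expr_root F 2 x.
- by rewrite FM dvdn_mulr.
- by rewrite FM mulKn // inE xM.
by apply/existsP; exists y; rewrite yx.
Qed.

(** Put A = x^5, u = A^(s-1), v = (1-A)^(s-1). Then A is a fifth power and 1 - A a square once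
    u^(2k) = 1 and v^(5k) = 1. A maximal curve of genus 2 has q + 1 + 4s points; leaving out the one
    at infinity, two with x = 0 and five with y = 0 produces the constant 7. *)
Lemma card_abscissae_1_minus_x5 k : s.+1 = (10 * k)%N ->
  (s ^ 2 + 4 * s <= 2 * #|curve_abscissae (1 - 'X^5)| + 7)%N.
Proof.
move=> sk; have k0 : (0 < k)%N by lia.
pose S := [set A : F | [&& A != 0, A != 1, A ^+ (s.-1 * (2 * k)) == 1
                         & (1 - A) ^+ (s.-1 * (5 * k)) == 1]].
have F5 : #|F|.-1 = (5 * (s.-1 * (2 * k)))%N by rewrite predn_cardF; lia.
have F2 : #|F|.-1 = (2 * (s.-1 * (5 * k)))%N by rewrite predn_cardF; lia.
have SX : (5 * #|S| <= #|curve_abscissae (1 - 'X^5)|)%N.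
  rewrite -card_preim_expr ?F5 ?dvdn_mulr //; last first.
    by rewrite mulKn //; apply/subsetP=> A; rewrite !inE => /and4P[].
  apply: subset_leq_card; apply/subsetP=> x.
  have fx : (1 - 'X^5).[x] = 1 - x ^+ 5 by rewrite !hornerE.
  rewrite !inE fx => /and4P[h1 h2 _ /eqP h4].
  rewrite subr_eq0 [1 == _]eq_sym h2 (exists_sqrt F2 h4) !andbT.
  by apply: contraNneq h1 => ->; rewrite expr0n.
(* Since gcd(2k, 5k) = k, the pairs to remove because u = v have u in [unity_roots F k]. *)
pose E := setX (unity_roots F (2 * k) :\ 1) (unity_roots F (5 * k) :\ 1)
            :\: [set (u, u) | u in unity_roots F k :\ 1].
have cU d : (d * k %| #|F|.-1)%N -> (#|unity_roots F (d * k) :\ 1%R| = (d * k).-1)%N.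
  by move=> dF; rewrite -[in RHS](card_unity_roots dF) (cardsD1 1 (unity_roots F _))
             one_unity_roots.
have cE : ((2 * k).-1 * (5 * k).-1 - k.-1 <= #|E|)%N.
  rewrite cardsD cardsX !cU; first last.
  - by rewrite F5; apply/dvdn_mull/dvdn_mull.
  - by rewrite F2; apply/dvdn_mull/dvdn_mull.
  apply: leq_sub2l; apply: leq_trans (subset_leq_card (subsetIr _ _)) _.
  apply: leq_trans (leq_imset_card _ _) _.
  by have := cU 1%N; rewrite mul1n => -> //; rewrite F2; do 3 apply: dvdn_mull.
have ES : (#|E| + s.-2 <= #|S|)%N.
  apply: card_ge_norm_one_pairs => //.
    have hU d w : (d %| 10)%N -> w \in unity_roots F (d * k) -> w \in unity_roots F s.+1.
      by move=> d10; rewrite sk; apply/subsetP/unity_roots_dvd; rewrite dvdn_pmul2r.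
    move=> u v; rewrite in_setD in_setX.
    move=> /andP[uv] /= /andP[/setD1P[u1 hu] /setD1P[v1 hv]].
    split=> //; [exact: hU hu|exact: hU hv|].
    apply: contraNneq uv => e; rewrite -e; apply/imsetP; exists u => //.
    move: hu hv; rewrite -e !inE u1 /= => /eqP hu.
    rewrite (_ : 5 * k = 2 * k * 2 + k)%N; last by lia.
    by rewrite exprD exprM hu expr1n mul1r.
  move=> A A0 A1; rewrite [A \in S]inE A0 A1 !(exprM _ s.-1) /= => /orP[|/andP[/eqP-> /eqP->]].
    by rewrite !inE /= => /andP[_ /andP[/andP[_ ->] /andP[_ ->]]].
  by rewrite !expr1n eqxx.
have [j kj] : exists j, k = j.+1 by exists k.-1; lia.
have sj : s = (10 * j.+1).-1 by lia.
have := leq_trans (leq_mul (leqnn 10) (leq_add cE (leqnn s.-2))) (leq_mul (leqnn 10) ES).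
move: #|S| #|curve_abscissae _| SX => S0 X0; rewrite kj {}sj {cE ES}.
rewrite (_ : (10 * j.+1).-1 ^ 2 = 100 * (j * j) + 180 * j + 81)%N; last by clear; nia.
rewrite (_ : (2 * j.+1).-1 * (5 * j.+1).-1 = 10 * (j * j) + 13 * j + 4)%N; last by clear; nia.
clear; lia.
Qed.

(** Here B = x^4. The condition says that x(1+x^4) has (4M)-th power 1, so it is a square; squaring
    the condition gives B^(2M) = 1, so B has four fourth roots. *)
Lemma card_abscissae_of_fibers (M : nat) (S : {set F}) : #|F|.-1 = (8 * M)%N ->
  (forall B, B \in S -> [/\ B != 0, 1 + B != 0 & B ^+ M * (1 + B) ^+ (4 * M) = 1]) ->
  (4 * #|S| <= #|curve_abscissae ('X^5 + 'X)|)%N.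
Proof.
move=> FM SP.
have F4 : #|F|.-1 = (4 * (2 * M))%N by rewrite FM; lia.
have F2 : #|F|.-1 = (2 * (4 * M))%N by rewrite FM; lia.
rewrite -card_preim_expr ?F4 ?dvdn_mulr //; last first.
  rewrite mulKn //; apply/subsetP=> B /SP[_ B1 /(congr1 (fun z => z ^+ 2))].
  rewrite exprMn -!exprM expr1n inE (_ : 4 * M * 2 = #|F|.-1)%N; last by rewrite FM; lia.
  by rewrite expf_predn_card // mulr1 mulnC => ->.
apply: subset_leq_card; apply/subsetP=> x.
have fx : ('X^5 + 'X).[x] = x * (1 + x ^+ 4) by rewrite !hornerE; ring.
rewrite !inE fx => /SP[h1 h2 h3].
have x0 : x != 0 by apply: contraNneq h1 => ->; rewrite expr0n.
rewrite x0 mulf_neq0 //= (exists_sqrt F2) //.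
by rewrite exprMn exprM h3.
Qed.

(** With x^4 = -A the fibre condition reads u^k v^(4k) = 1, where u = A^(s-1) and v = (1-A)^(s-1).
    The constant 5 stands for the five points with y = 0, the point at infinity cancelling the 1 in
    q + 1 + 4s. *)
Lemma card_abscissae_x5_plus_x_7mod8 k : s.+1 = (8 * k)%N ->
  (s ^ 2 + 4 * s <= 2 * #|curve_abscissae ('X^5 + 'X)| + 5)%N.
Proof.
move=> sk; have k0 : (0 < k)%N by lia.
pose S := [set A : F | [&& A != 0, A != 1 &
                         A ^+ (s.-1 * k) * (1 - A) ^+ (s.-1 * (4 * k)) == 1]].
have F8 : #|F|.-1 = (8 * (s.-1 * k))%N by rewrite predn_cardF; lia.
have SX : (4 * #|S| <= #|curve_abscissae ('X^5 + 'X)|)%N.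
  rewrite -(card_imset _ (@oppr_inj F)); apply: card_abscissae_of_fibers F8 _.
  move=> B /imsetP[A AS ->]; move: AS; rewrite inE => /and3P[A0 A1 /eqP e].
  split; rewrite ?oppr_eq0 //; first by rewrite subr_eq0 eq_sym.
  rewrite (_ : 4 * (s.-1 * k) = s.-1 * (4 * k))%N; last lia.
  rewrite -[RHS]e exprNn -signr_odd (_ : odd _ = false) ?expr0 ?mul1r //.
  have -> : s.-1 = (2 * (4 * k).-1)%N by lia.
  by rewrite !oddM.
pose U d := unity_roots F (d * k).
have cU d : (d %| 8)%N -> #|U d| = (d * k)%N.
  move=> d8; apply: card_unity_roots.
  by rewrite F8 [(8 * _)%N]mulnCA mulnA -mulnA dvdn_mull // dvdn_mul.
have U1 d : 1 \in U d by exact: one_unity_roots.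
have UU d e : (d %| e)%N -> U d \subset U e.
  by move=> de; apply: unity_roots_dvd; rewrite dvdn_pmul2r.
(* On [E1] both u^k and v^(4k) are 1, on [E2] both are -1. Only [E1] can contain pairs with u =
   v. *)
pose E1 := setX (U 1%N :\ 1) (U 4%N :\ 1) :\: [set (u, u) | u in U 1%N :\ 1].
pose E2 := setX (U 2%N :\: U 1%N) (U 8%N :\: U 4%N).
have c1 : (#|U 1%N :\ 1%R| = k.-1)%N.
  by have := cU 1%N isT; rewrite (cardsD1 1 (U 1%N)) U1 mul1n => <-.
have c4 : (#|U 4%N :\ 1%R| = (4 * k).-1)%N.
  by rewrite -(cU 4%N isT) (cardsD1 1 (U 4%N)) U1.
have cE1 : (k.-1 * (4 * k).-1 - k.-1 <= #|E1|)%N.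
  rewrite cardsD cardsX c1 c4; apply: leq_sub2l.
  apply: leq_trans (subset_leq_card (subsetIr _ _)) _.
  by apply: leq_trans (leq_imset_card _ _) _; rewrite c1.
have cE2 : #|E2| = (k * (4 * k))%N.
  rewrite cardsX !cardsD.
  rewrite (setIidPr (UU 1%N 2%N isT)) (setIidPr (UU 4%N 8%N isT)) !cU //.
  by congr (_ * _)%N; lia.
have cE : (#|E1| + #|E2| = #|E1 :|: E2|)%N.
  rewrite -cardsUI (_ : E1 :&: E2 = set0) ?cards0 ?addn0 //.
  by apply/setP=> -[u v]; rewrite !inE /=; do !case: (_ == _); rewrite ?andbF.
have ES : (#|E1 :|: E2| + s.-2 <= #|S|)%N.
  apply: card_ge_norm_one_pairs => //.
    have hU d w : (d %| 8)%N -> w \in U d -> w \in unity_roots F s.+1.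
      by move=> d8; rewrite sk; apply/subsetP; apply: UU.
    move=> u v; rewrite in_setU => /orP[|].
      rewrite in_setD in_setX => /andP[uv] /= /andP[/setD1P[u1 hu] /setD1P[v1 hv]].
      split=> //; [exact: hU hu|exact: hU hv|].
      apply: contraNneq uv => e; rewrite -e; apply/imsetP; exists u => //.
      by rewrite in_setD1 u1.
    rewrite in_setX /= => /andP[/setDP[hu hu1] /setDP[hv hv4]].
    split; [exact: hU hu|exact: hU hv|..].
    - by apply: contraNneq hu1 => ->.
    - by apply: contraNneq hv4 => ->.
    - by apply: contraNneq hv4 => <-; apply: (subsetP (UU 2%N 4%N isT)).
  move=> A A0 A1; rewrite [A \in S]inE A0 A1 !(exprM _ s.-1) /=.
  move: (A ^+ s.-1) ((1 - A) ^+ s.-1) => u v.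
  have pm (w : F) n : w ^+ (2 * n) = 1 -> w ^+ n != 1 -> w ^+ n = -1.
    by rewrite mulnC exprM => /eqP; rewrite sqrf_eq1 => /orP[->|/eqP->].
  case/orP=> [|/andP[/eqP-> /eqP->]]; last by rewrite !expr1n mulr1.
  rewrite in_setU => /orP[|].
    rewrite in_setD in_setX => /andP[_] /= /andP[/setD1P[_ hu] /setD1P[_ hv]].
    by move: hu hv; rewrite !inE mul1n => /eqP-> /eqP->; rewrite mulr1.
  rewrite in_setX /= => /andP[/setDP[hu hu1] /setDP[hv hv4]].
  move: hu hu1 hv hv4; rewrite !inE mul1n => /eqP hu hu1 /eqP hv hv4.
  rewrite (pm _ _ hu hu1) (pm _ _ _ hv4) ?mulrNN ?mulr1 //.
  by rewrite -[RHS]hv; congr (_ ^+ _); lia.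
have [j kj] : exists j, k = j.+1 by exists k.-1; lia.
have sj : s = (8 * j.+1).-1 by lia.
have := leq_trans (leq_mul (leqnn 8) (leq_add (leq_add cE1 (leqnn #|E2|)) (leqnn s.-2))).
move=> /(_ (8 * #|S|)%N); rewrite cE leq_mul2l ES => /(_ isT).
move: #|S| #|curve_abscissae _| SX => S0 X0; rewrite cE2 kj {}sj {cE ES}.
rewrite (_ : (8 * j.+1).-1 ^ 2 = 64 * (j * j) + 112 * j + 49)%N; last by clear; nia.
rewrite (_ : j.+1.-1 * (4 * j.+1).-1 - j.+1.-1 = 4 * (j * j) + 2 * j)%N; last by clear; nia.
rewrite (_ : j.+1 * (4 * j.+1) = 4 * (j * j) + 8 * j + 4)%N; last by clear; nia.
clear; lia.
Qed.

(** Let N = c^(s+1), an element of the subfield of order s. Then 1 + phi(c) = (1-N)/(1-c), so (1 +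
    phi(c))^(s-1) is the inverse of (1-c)^(s-1). This inverts [phi] on [T1] and reduces the fibre
    condition at phi(c) to c^M = 1. The set [T2] supplies the remaining values of x^4. *)
Lemma card_abscissae_x5_plus_x_5mod8 k : s = (8 * k + 5)%N ->
  (s ^ 2 + 4 * s <= 2 * #|curve_abscissae ('X^5 + 'X)| + 5)%N.
Proof.
move=> sk; pose M := ((2 * k + 1) * (4 * k + 3))%N.
have F8 : #|F|.-1 = (8 * M)%N by rewrite predn_cardF /M; nia.
have frobD (x y : F) : (x + y) ^+ s = x ^+ s + y ^+ s by rewrite exprDn_pchar.
have frobB (x y : F) : (x - y) ^+ s = x ^+ s - y ^+ s.
  by rewrite exprDn_pchar // exprNn_pchar.
have sS (x : F) : x ^+ s = x * x ^+ s.-1 by rewrite -exprS prednK // ltnW.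
have s2 : (s * s = #|F|)%N by rewrite cardF.
pose T1 := unity_roots F M :\: unity_roots F s.+1.
pose T2 := unity_roots F s.+1 :\ -1.
pose phi (c : F) := c * (1 - c) ^+ s.-1.
have phiP c : c \in T1 -> [/\ c != 0, 1 - c != 0, phi c ^+ s.+1 = c ^+ s.+1,
     1 - c ^+ s.+1 != 0 & 1 + phi c = (1 - c ^+ s.+1) / (1 - c)].
  rewrite !inE => /andP[hc /eqP cM].
  have c1 : 1 - c != 0.
    by rewrite subr_eq0; apply: contraNneq hc => <-; rewrite expr1n.
  have c0 : c != 0.
    apply: contraTneq isT => c0; move/eqP: cM; rewrite c0 expr0n eq_sym gtn_eqF ?oner_eq0 //.
    by rewrite /M muln_gt0; lia.
  split=> //.
  - rewrite exprMn -exprM -predn_cardF expf_predn_card // mulr1 //.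
  - by rewrite subr_eq0 eq_sym.
  apply: (mulIf c1); rewrite divfK // /phi mulrDl mul1r -mulrA -exprSr prednK 1?ltnW //.
  by rewrite frobB expr1n exprS; ring.
have normK (c : F) : 1 - c ^+ s.+1 != 0 -> (1 - c ^+ s.+1) ^+ s.-1 = 1.
  move=> N0; apply: (mulfI N0); rewrite mulr1 -sS frobB expr1n; congr (1 - _).
  by rewrite -exprM mulSn exprD s2 expf_card -exprSr.
have phi_inj : {in T1 &, injective phi}.
  have key c : c \in T1 -> phi c * (1 + phi c) ^+ s.-1 = c.
    move=> /phiP[c0 c1 _ N0 ->].
    by rewrite /phi expr_div_n normK // mul1r mulfK ?expf_neq0.
  by move=> c c' hc hc' e; rewrite -[c]key // e key.
(* [phi] preserves the norm, so no value on [T1] has norm 1. *)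
have T12 : [disjoint phi @: T1 & T2].
  rewrite disjoint_subset; apply/subsetP=> _ /imsetP[c hc ->].
  have [_ _ e N0 _] := phiP _ hc.
  by rewrite !inE negb_and e [_ == 1]eq_sym -(subr_eq0 1) N0 orbT.
have cT2 : (s <= #|T2|)%N.
  have h : (s.+1 %| #|F|.-1)%N by rewrite predn_cardF dvdn_mull.
  have := cardsD1 (-1) (unity_roots F s.+1); rewrite (card_unity_roots h).
  by rewrite -/T2; move: #|T2| => n; case: (_ \in _); lia.
(* As M = (s+1)k + (4k+3), elements of norm 1 with c^M = 1 are (4k+3)-th roots of unity. *)
have cT1 : (M - (4 * k + 3) <= #|T1|)%N.
  have cM : #|unity_roots F M| = M.
    by apply: card_unity_roots; rewrite F8 [(8 * M)%N]mulnC dvdn_mulr ?dvdnn.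
  rewrite /T1 cardsD cM; apply: leq_sub2l.
  have n0 : (0 < 4 * k + 3)%N by lia.
  apply: leq_trans (card_unity_roots_le F n0); apply: subset_leq_card.
  apply/subsetP=> x; rewrite !inE => /andP[/eqP xM /eqP xs].
  apply/eqP; rewrite -[RHS]xM (_ : M = s.+1 * k + (4 * k + 3))%N; last by rewrite /M; nia.
  by rewrite (exprD _ (s.+1 * k)%N) exprM xs expr1n mul1r.
have ST : (#|T1| + #|T2| = #|phi @: T1 :|: T2|)%N.
  by rewrite -(card_in_imset phi_inj); apply/esym/eqP; rewrite (leq_card_setU _ _).2.
have SX : (4 * #|phi @: T1 :|: T2| <= #|curve_abscissae ('X^5 + 'X)|)%N.
  apply: (card_abscissae_of_fibers F8) => B; rewrite in_setU => /orP[|].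
    case/imsetP=> c hc ->; have [c0 c1 _ N0 e] := phiP _ hc.
    split; rewrite ?mulf_neq0 ?expf_neq0 // e ?mulf_neq0 ?invr_neq0 //.
    have wM : ((1 - c) ^+ (4 * M)) ^+ 2 = 1.
      by rewrite -exprM (_ : 4 * M * 2 = #|F|.-1)%N ?expf_predn_card // F8; lia.
    have s1M : (s.-1 * M = 4 * M * 2 * k + 4 * M)%N.
      by rewrite (_ : s.-1 = 4 * 2 * k + 4)%N; lia.
    have M4 : (4 * M = s.-1 * (4 * k + 3))%N.
      by rewrite (_ : s.-1 = 4 * (2 * k + 1))%N /M; lia.
    rewrite exprMn -exprM s1M exprD 2!exprM wM expr1n mul1r expr_div_n.
    have -> : c ^+ M = 1 by move: hc; rewrite !inE => /andP[_ /eqP].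
    rewrite mul1r mulrCA divff ?expf_neq0 // mulr1.
    by rewrite M4 (exprM _ s.-1) normK // expr1n.
  rewrite !inE => /andP[B1 /eqP Bs].
  have B0 : B != 0.
    by apply/eqP=> B0; move/eqP: Bs; rewrite B0 exprS mul0r eq_sym oner_eq0.
  have B10 : 1 + B != 0 by rewrite addrC -[1]opprK subr_eq0.
  split=> //.
  (* For B of norm 1, B(1+B)^s = B + B^(s+1) = 1 + B. The fibre condition is then the (4k+3)-th
     power of this identity, because M is 4k+3 modulo s+1 and 4M = (s-1)(4k+3). *)
  have B1s : B * (1 + B) ^+ s.-1 = 1.
    apply: (mulIf B10); rewrite mul1r -mulrA -exprSr prednK 1?ltnW //.
    by rewrite frobD expr1n mulrDr mulr1 -exprS Bs addrC.
  have M4 : (4 * M = s.-1 * (4 * k + 3))%N.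
    by rewrite (_ : s.-1 = 4 * (2 * k + 1))%N /M; lia.
  rewrite M4 exprM (_ : M = s.+1 * k + (4 * k + 3))%N; last by rewrite /M; nia.
  by rewrite exprD exprM Bs expr1n mul1r -exprMn B1s expr1n.
move: ST SX (leq_add cT1 cT2) => <-; move: (#|T1| + #|T2|)%N => T.
move: #|curve_abscissae _| => X0; rewrite /M sk.
rewrite (_ : (8 * k + 5) ^ 2 = 64 * (k * k) + 80 * k + 25)%N; last by clear; nia.
rewrite (_ : _ * _ - _ = 8 * (k * k) + 6 * k)%N; last by clear; nia.
clear; lia.
Qed.
End CurvePoints.

(** * Zeros of A(x) + y B(x) on a curve y^2 = f(x), and polynomials with prescribed exponents *)

Section HyperellipticZeros.
Local Open Scope ring_scope.
Variable F : fieldType.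
Implicit Types (f A B : {poly F}) (ps : seq (F * F)).

(* When two points of ps share an abscissa c, both A and B vanish at c, and
   dividing them by X - c removes two zeros of the norm A^2 - B^2 f. *)
Lemma size_zeros_lt_norm f A B ps :
  uniq ps ->
  {in ps, forall w, w.2 ^+ 2 = f.[w.1] /\ A.[w.1] + w.2 * B.[w.1] = 0} ->
  A ^+ 2 - B ^+ 2 * f != 0 -> (size ps < size (A ^+ 2 - B ^+ 2 * f)%R)%N.
Proof.
have [n] := ubnP (size ps); elim: n A B ps => // n IHn A B ps ltn ups psP N0.
have [u1|] := boolP (uniq (map fst ps)).
  rewrite -(size_map fst); apply: max_poly_roots => //.
  apply/allP=> _ /mapP[w /psP[e1 e2] ->]; rewrite /root !hornerE -e1.
  have -> : A.[w.1] = - (w.2 * B.[w.1]) by apply/eqP; rewrite -addr_eq0 e2.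
  by apply/eqP; ring.
move/(uniqPn 0) => [i [j [ij js e]]]; rewrite size_map in js.
have is_ := ltn_trans ij js.
set c := nth 0 (map fst ps) i in e.
have wi := mem_nth (0, 0) is_; have wj := mem_nth (0, 0) js.
have ci : (nth (0, 0) ps i).1 = c by rewrite /c (nth_map (0, 0)).
have cj : (nth (0, 0) ps j).1 = c by rewrite e (nth_map (0, 0)).
have [_] := psP _ wi; have [_] := psP _ wj; rewrite ci cj => ej ei.
have dij : (nth (0, 0) ps i).2 != (nth (0, 0) ps j).2.
  apply/negP=> /eqP e2.
  have : nth (0, 0) ps i == nth (0, 0) ps j.
    by rewrite [nth _ _ i]surjective_pairing [nth _ _ j]surjective_pairing ci cj e2.
  by rewrite nth_uniq // ltn_eqF.
have Bc : B.[c] = 0.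
  apply/eqP; have : ((nth (0, 0) ps i).2 - (nth (0, 0) ps j).2) * B.[c] == 0.
    by rewrite mulrBl subr_eq0; apply/eqP/(addrI A.[c]); rewrite ei ej.
  by rewrite mulf_eq0 subr_eq0 (negbTE dij).
have Ac : A.[c] = 0 by move: ei; rewrite Bc mulr0 addr0.
have /factor_theorem[B' B'E] : root B c by rewrite /root Bc.
have /factor_theorem[A' A'E] : root A c by rewrite /root Ac.
have NE : A ^+ 2 - B ^+ 2 * f = (A' ^+ 2 - B' ^+ 2 * f) * ('X - c%:P) ^+ 2.
  by rewrite A'E B'E; ring.
have N'0 : A' ^+ 2 - B' ^+ 2 * f != 0.
  by apply: contraNneq N0 => z; rewrite NE z mul0r.
have -> : size (A ^+ 2 - B ^+ 2 * f) = (size (A' ^+ 2 - B' ^+ 2 * f)%R + 2)%N.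
  rewrite NE size_Mmonic ?monic_exp ?monicXsubC // size_exp_XsubC.
  by rewrite addnS.
rewrite -(count_predC (fun w => w.1 != c) ps) -size_filter -[X in (_ + X)%N]size_filter.
rewrite -addSn; apply: leq_add.
  apply: IHn; rewrite ?filter_uniq //.
    rewrite -ltnS; apply: leq_trans ltn; rewrite ltnS size_filter.
    rewrite -(count_predC (fun w => w.1 != c) ps) -addn1 leq_add2l -has_count.
    by apply/hasP; exists (nth (0, 0) ps i) => //=; rewrite ci negbK.
  move=> w; rewrite mem_filter => /andP[wc /psP[e1]]; rewrite A'E B'E !hornerM hornerXsubC => e2.
  split=> //; have wc0 : w.1 - c != 0 by rewrite subr_eq0.
  by apply: (mulIf wc0); rewrite mul0r -[RHS]e2; ring.
(* At most two points lie over [c], their ordinates being roots of X^2 - f(c); this matches the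
   degree lost with (X-c)^2. *)
rewrite -(size_map snd) -ltnS -(size_XnsubC f.[c] (isT : 0 < 2)%N).
apply: max_poly_roots.
- by rewrite -size_poly_gt0 size_XnsubC.
- apply/allP=> _ /mapP[w + ->]; rewrite mem_filter /= negbK => /andP[/eqP wc /psP[e1 _]].
  by rewrite /root !hornerE e1 wc subrr.
rewrite map_inj_in_uniq ?filter_uniq // => w w'.
rewrite !mem_filter /= !negbK => /andP[/eqP wc _] /andP[/eqP wc' _] e2.
by rewrite [w]surjective_pairing [w']surjective_pairing wc wc' e2.
Qed.

(* The degrees of A^2 and B^2 f have different parities. *)
Lemma norm_quintic f A B d : size f = 6 -> (A != 0) || (B != 0) ->
  (size A <= d.+1)%N -> ((size B).+1 <= d)%N \/ B = 0 ->
  A ^+ 2 - B ^+ 2 * f != 0 /\ (size (A ^+ 2 - B ^+ 2 * f)%R <= d.*2.+2)%N.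
Proof.
move=> sf AB sA sB.
have size_sqr (p : {poly F}) : p != 0 -> size (p ^+ 2) = (size p).*2.-1.
  by move=> p0; rewrite expr2 size_mul // addnn.
have [B0|B0] := eqVneq B 0.
  rewrite B0 eqxx orbF in AB; rewrite B0 expr0n mul0r subr0 expf_neq0 //; split=> //.
  by rewrite size_sqr //; move: sA; clear; lia.
have f0 : f != 0 by rewrite -size_poly_gt0 sf.
have sBf : size (B ^+ 2 * f) = ((size B).*2 + 4)%N.
  rewrite size_mul ?expf_neq0 // size_sqr // sf.
  by move: B0; rewrite -size_poly_gt0; lia.
have {}sB : ((size B).+1 <= d)%N by case: sB => // /eqP; rewrite (negbTE B0).
have sA2 : (size (A ^+ 2)%R <= d.*2.+1)%N by apply: leq_trans (size_poly_exp_leq _ _) _; lia.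
split.
  rewrite subr_eq0; apply: contraTneq isT => e.
  have := congr1 (fun q : {poly F} => odd (size q)) e.
  rewrite sBf oddD odd_double /=.
  have A0 : A != 0.
    apply: contraNneq B0 => A0; move/eqP: e.
    by rewrite A0 expr0n eq_sym mulf_eq0 (negbTE f0) orbF expf_eq0.
  by rewrite size_sqr //; move: A0; rewrite -size_poly_gt0; lia.
apply: leq_trans (size_polyD _ _) _; rewrite size_polyN sBf geq_max; lia.
Qed.

Definition sparse_poly N (tau : nat -> nat) (a : 'rV[F]_N) : {poly F} :=
  \sum_(e < N) a ord0 e *: 'X^(tau e).

Lemma sparse_poly_linear N tau : linear (@sparse_poly N tau).
Proof.
move=> c a b; rewrite /sparse_poly scaler_sumr -big_split /=.
by apply: eq_bigr => e _; rewrite !mxE scalerDl scalerA.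
Qed.

HB.instance Definition _ N tau :=
  GRing.isLinear.Build F 'rV[F]_N {poly F} _ (@sparse_poly N tau) (sparse_poly_linear tau).

Lemma horner_sparse_poly N tau (a : 'rV[F]_N) z :
  (sparse_poly tau a).[z] = \sum_(e < N) a ord0 e * z ^+ tau e.
Proof. by rewrite horner_sum; apply: eq_bigr => e _; rewrite !hornerE. Qed.

Lemma size_sparse_poly N tau (a : 'rV[F]_N) d :
  (forall e, (e < N)%N -> (tau e < d)%N) -> (size (sparse_poly tau a) <= d)%N.
Proof.
move=> td; apply: leq_trans (size_sum _ _ _) _; apply/bigmax_leqP=> e _.
by apply: leq_trans (size_scale_leq _ _) _; rewrite size_polyXn td.
Qed.

Lemma sparse_poly_eq0 N tau (a : 'rV[F]_N) : injective tau ->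
  sparse_poly tau a = 0 -> a = 0.
Proof.
move=> tinj a0; apply/rowP=> e; rewrite mxE.
have := congr1 (fun q : {poly F} => q`_(tau e)) a0; rewrite coef0 => <-.
rewrite coef_sum (bigD1 e) //= coefZ coefXn eqxx mulr1 big1 ?addr0 // => e' ne.
by rewrite coefZ coefXn (inj_eq tinj) eq_sym val_eqE (negbTE ne) mulr0.
Qed.

Lemma sum_expr_unity_root m (z : F) : z ^+ m = 1 -> z != 1 -> \sum_(k < m) z ^+ k = 0.
Proof.
move=> zm z1; apply/eqP; have := subrX1 z m.
by rewrite zm subrr => /esym/eqP; rewrite mulf_eq0 subr_eq0 (negbTE z1).
Qed.

End HyperellipticZeros.

(** The e-th natural number, counted from 0, that is not -1 modulo h: one exponent is skipped after
    every h-1. *)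
Definition skip_exponent (h e : nat) : nat := e + e %/ h.-1.

Lemma skip_exponent_inj h : injective (skip_exponent h).
Proof.
have mono e e' : e < e' -> skip_exponent h e < skip_exponent h e'.
  by move=> lee; rewrite /skip_exponent -addSn leq_add // leq_div2r // ltnW.
move=> e e' ee; apply/eqP; rewrite eqn_leq leqNgt [e' <= e]leqNgt.
by apply/andP; split; apply/negP=> /mono; rewrite ee ltnn.
Qed.

Lemma skip_exponent_ndvd h e : 1 < h -> ~~ (h %| (skip_exponent h e).+1).
Proof.
move=> h1; have h0 : 0 < h.-1 by lia.
rewrite /skip_exponent {1}(divn_eq e h.-1) addnAC -mulnSr prednK 1?ltnW //.
rewrite -addnS dvdn_addr ?dvdn_mull // gtnNdvd //.
by have := ltn_pmod e h0; lia.
Qed.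

(** The first u(h-1) exponents fill u blocks of length h, each ending in a skipped one. As hu-1
    itself is skipped, the bound gains the one degree that [norm_quintic] requires of B. *)
Lemma skip_exponent_lt h u e : 1 < h -> e < u * h.-1 ->
  skip_exponent h e < (h * u).-1.
Proof.
move=> h1 eu; have h0 : 0 < h.-1 by lia.
have q : e %/ h.-1 < u by rewrite ltn_divLR.
rewrite /skip_exponent; move: (e %/ h.-1) q => v q.
have -> : (h * u).-1 = (u * h.-1 + u).-1.
  by case: h h1 {eu h0} => //= h _; rewrite mulSn mulnC addnC.
by clear h0 h1; lia.
Qed.

Lemma leq_min_dist (F : finFieldType) n (C : {vspace 'rV[F]_n}) w :
  w <= n -> (forall c, c \in C -> c != 0%R -> w <= wt c) -> w <= min_dist C.
Proof.
move=> wn wC; rewrite /min_dist; elim/big_ind: _ => //.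
  by move=> a b wa wb; rewrite leq_min wa wb.
by move=> c /andP[cC c0]; apply: wC.
Qed.

(** * The evaluation code of a curve with an automorphism of order 2h *)

Section CurveCode.
Local Open Scope ring_scope.
Variables (F : finFieldType) (h r t l : nat) (xi : F) (f : {poly F}).
Variables (x y : 'I_l -> F).
Hypotheses (h_gt1 : (1 < h)%N) (r_h : (r + 1 = 2 * h)%N).
Hypothesis xi_prim : (2 * h).-primitive_root xi.
Hypotheses (size_f : size f = 6) (f_equiv : forall z, f.[xi ^+ 2 * z] = xi ^+ 10 * f.[z]).
Hypotheses (x_neq0 : forall j, x j != 0) (y_neq0 : forall j, y j != 0).
Hypothesis on_curve : forall j, y j ^+ 2 = f.[x j].
Hypothesis x_inj : injective (fun j => x j ^+ h).
Hypotheses (t_gt0 : (0 < t)%N) (t_le : (t <= l)%N).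

Local Notation n := (l * (r + 1))%N.
Local Notation T := ('I_l * 'I_(r + 1))%type.
(** Coefficient spaces of A and B. At infinity x has a pole of order 2 and y one of order 5, so A
    has degree at most h(t-1) and B at most h(t-1)-2. The dimensions add up to r(t-1)+1. *)
Local Notation K := 'rV[F]_(h * t.-1).+1.
Local Notation K' := 'rV[F]_(t.-1 * h.-1).

Let card_T : #|{: T}| = n.
Proof. by rewrite card_prod !card_ord. Qed.

Let unidx (i : 'I_n) : T := enum_val (cast_ord (esym card_T) i).
Let idx (w : T) : 'I_n := cast_ord card_T (enum_rank w).

Let idxK : cancel idx unidx.
Proof. by move=> w; rewrite /unidx /idx cast_ordK enum_rankK. Qed.
Let unidxK : cancel unidx idx.
Proof. by move=> i; rewrite /unidx /idx enum_valK cast_ordKV. Qed.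

Let point (w : T) : F * F := (xi ^+ (2 * w.2) * x w.1, xi ^+ (5 * w.2) * y w.1).

Let h_gt0 : (0 < h)%N := ltnW h_gt1.

Let xi_neq0 : xi != 0.
Proof.
apply/eqP=> xi0; have := prim_expr_order xi_prim.
by rewrite xi0 expr0n gtn_eqF ?muln_gt0 //= => /esym/eqP; rewrite oner_eq0.
Qed.

(** x^h is constant on an orbit, as xi^2 has order h, and [x_inj] separates the orbits. Inside an
    orbit, xi^k is recovered as xi^(5k) / (xi^(2k))^2. *)
Let point_inj : injective point.
Proof.
move=> [j k] [j' k'] [] /= e2 e5.
have jj : j = j'.
  apply: x_inj; have := congr1 (fun z => z ^+ h) e2; rewrite /= !exprMn -!exprM.
  have xi1 i : xi ^+ (2 * i * h) = 1.
    by rewrite mulnAC exprM (prim_expr_order xi_prim) expr1n.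
  by rewrite !xi1 !mul1r.
rewrite -{j'}jj in e2 e5 *.
move/(mulIf (x_neq0 j)): e2 => e2; move/(mulIf (y_neq0 j)): e5 => e5.
have e1 : xi ^+ k == xi ^+ k'.
  apply/eqP; have z : xi ^+ (2 * k) ^+ 2 != 0 by rewrite !expf_neq0.
  have s5 i : xi ^+ (5 * i) = xi ^+ i * xi ^+ (2 * i) ^+ 2.
    by rewrite -exprM -exprD; congr (_ ^+ _); lia.
  by apply: (mulIf z); rewrite -s5 e5 e2 -s5.
congr (_, _); apply/val_inj/eqP => /=.
by move: e1; rewrite (eq_prim_root_expr xi_prim) !modn_small // -r_h.
Qed.

Let point_on_curve w : (point w).2 ^+ 2 = f.[(point w).1].
Proof.
rewrite /point /=; elim: (nat_of_ord w.2) => [|k IHk].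
  by rewrite !muln0 !mul1r on_curve.
have -> : xi ^+ (2 * k.+1) * x w.1 = xi ^+ 2 * (xi ^+ (2 * k) * x w.1).
  by rewrite mulnS exprD mulrA.
by rewrite f_equiv -IHk mulnS exprD -mulrA exprMn -exprM.
Qed.

Let pairP := (K * K')%type.
Let polA (v : pairP) : {poly F} := sparse_poly id v.1.
Let polB (v : pairP) : {poly F} := sparse_poly (skip_exponent h) v.2.
Let ev (v : pairP) : 'rV[F]_n :=
  \row_i ((polA v).[(point (unidx i)).1] + (point (unidx i)).2 * (polB v).[(point (unidx i)).1]).

Let ev_linear : linear ev.
Proof.
move=> a u v; apply/rowP=> i; rewrite !mxE /polA /polB !linearP.
by rewrite !hornerD !hornerZ; ring.
Qed.

HB.instance Definition _ := GRing.isLinear.Build F pairP 'rV[F]_n _ ev ev_linear.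

Let zeros_ev v : v != 0 -> (#|[set i | ev v ord0 i == 0%R]| <= (t - 1) * (r + 1) + 1)%N.
Proof.
move=> v0; have [|||N0 sN] := @norm_quintic _ f (polA v) (polB v) (h * t.-1) size_f.
- apply: contraNT v0; rewrite negb_or !negbK => /andP[/eqP a0 /eqP b0].
  rewrite [v]surjective_pairing (sparse_poly_eq0 _ a0) ?(sparse_poly_eq0 _ b0) //.
  exact: skip_exponent_inj.
- by apply: size_sparse_poly => e.
(* For t = 1 the space of B is zero, which is the second alternative of [norm_quintic]. *)
- have [t1|t1] := posnP t.-1.
    right; rewrite /polB /sparse_poly big1 // => e _.
    by suff : (e < 0)%N by []; rewrite -[X in (_ < X)%N](mul0n h.-1) -t1.
  left; have ht : (0 < h * t.-1)%N by rewrite muln_gt0 t1 ltnW.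
  rewrite -(prednK ht) ltnS; apply: size_sparse_poly => e.
  exact: skip_exponent_lt.
set Z := [set i | _].
have -> : #|Z| = size [seq point (unidx i) | i <- enum Z] by rewrite size_map -cardE.
rewrite -ltnS; apply: leq_trans (leq_trans (size_zeros_lt_norm _ _ N0) sN) _.
- rewrite map_inj_uniq ?enum_uniq // => i i' /point_inj.
  exact: (can_inj unidxK).
- move=> _ /mapP[i + ->]; rewrite mem_enum inE mxE => /eqP e.
  by rewrite point_on_curve.
by rewrite r_h subn1; clear; lia.
Qed.

Let n_gt : ((t - 1) * (r + 1) + 1 < n)%N.
Proof.
apply: (@leq_trans (t * (r + 1))); last by rewrite leq_mul2r t_le orbT.
rewrite r_h; move: h_gt1; case: t t_gt0 => // t' _; rewrite subn1 /= mulSn; lia.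
Qed.

Let ev_inj v : ev v = 0 -> v = 0.
Proof.
move=> e; apply: contraTeq n_gt => /zeros_ev; rewrite -leqNgt; apply: leq_trans.
rewrite -[X in (X <= _)%N]card_ord; apply: subset_leq_card.
by apply/subsetP=> i _; rewrite inE e mxE.
Qed.

(** The parity check of an orbit. The weight exponent is r-2 = 2h-3: then x^e sums a geometric
    progression with ratio xi to the odd power 2e+r-2, and x^e y one with ratio xi^(2(e+1)+2h). The
    latter ratio is 1 exactly when h divides e+1. *)
Let sum_block v j :
  \sum_(k < r + 1) ev v ord0 (idx (j, k)) * (xi ^+ (r - 2)) ^+ k = 0.
Proof.
have r3 : (2 < r)%N by lia.
have mono c E : ~~ (2 * h %| E)%N -> \sum_(k < r + 1) c * xi ^+ E ^+ k = 0.
  move=> hE; rewrite -mulr_sumr sum_expr_unity_root ?mulr0 //.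
    by rewrite r_h -exprM mulnC exprM (prim_expr_order xi_prim) expr1n.
  by rewrite -(prim_order_dvd xi_prim).
transitivity (\sum_(k < r + 1)
   (\sum_(e < (h * t.-1).+1) v.1 ord0 e * x j ^+ e * xi ^+ (2 * e + (r - 2)) ^+ k
   + \sum_(e < t.-1 * h.-1) v.2 ord0 e * y j * x j ^+ skip_exponent h e *
        xi ^+ (2 * skip_exponent h e + 5 + (r - 2)) ^+ k)).
  apply: eq_bigr => k _; rewrite mxE idxK !horner_sparse_poly /= mulrDl mulr_sumr !mulr_suml.
  have hx d c : xi ^+ (2 * d + c + (r - 2)) ^+ k =
      xi ^+ (2 * k) ^+ d * xi ^+ (c * k) * xi ^+ (r - 2) ^+ k.
    rewrite -!exprM -!exprD; congr (_ ^+ _).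
    by move: (r - 2)%N (nat_of_ord k) => u k'; clear; lia.
  congr (_ + _); apply: eq_bigr => e _; rewrite exprMn.
    by have := hx e 0%N; rewrite addn0 mul0n expr0 mulr1 => ->; ring.
  by rewrite hx; move: (skip_exponent h e) => d; ring.
rewrite big_split /= exchange_big /= [X in _ + X]exchange_big /=.
rewrite !big1 ?addr0 // => e _; apply: mono.
  apply/negP=> d; have := skip_exponent_ndvd e h_gt1.
  rewrite -(dvdn_pmul2l (isT : 0 < 2)%N) => /negP[].
  rewrite -(dvdn_addl _ (dvdnn (2 * h))) -[X in (_ %| _ + X)%N]r_h.
  rewrite (_ : _ + _ = 2 * skip_exponent h e + 5 + (r - 2))%N //.
  by move: (skip_exponent h e) r3 => u; clear; lia.
have /negP nd : ~~ (2 %| 2 * e + (r - 2))%N.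
  by move: r_h r3; clear; rewrite dvdn2; lia.
by apply/negP=> d; apply: nd; apply: dvdn_trans d; rewrite dvdn_mulr.
Qed.

Lemma lrc_of_curve : exists C : {vspace 'rV[F]_n},
  [/\ \dim C = (r * t - (r - 1))%N,
      has_locality C r,
      ((l * (r + 1))%:Z - ((t - 1) * (r + 1))%:Z - 1 <= (min_dist C)%:Z)%R &
      (lrc_defect (l * (r + 1)) (\dim C) (min_dist C) r <= 1)%R].
Proof.
have CP c : c \in limg (linfun ev) -> exists v, c = ev v.
  by case/memv_imgP=> v _ ->; exists v; rewrite lfunE.
have dimC : \dim (limg (linfun ev)) = (r * t - (r - 1))%N.
  rewrite limg_dim_eq.
    rewrite dimvf /dim /= /dim /= !mul1n; move: r_h h_gt1 t_gt0; clear.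
    by case: t => // t' e h1 _; rewrite (_ : r = h + h.-1)%N; case: h h1 e => //; nia.
  apply/eqP; rewrite -subv0; apply/subvP=> v; rewrite memv_cap memv_ker lfunE /=.
  by case/andP=> _ /eqP/ev_inj->; rewrite mem0v.
exists (limg (linfun ev)).
have dC : (n - ((t - 1) * (r + 1) + 1) <= min_dist (limg (linfun ev)))%N.
  apply: leq_min_dist => [|c /CP[v ->] c0]; first exact: leq_subr.
  have v0 : v != 0 by apply: contraNneq c0 => ->; rewrite linear0.
  rewrite leq_subLR; apply: leq_trans (leq_add (zeros_ev v0) (leqnn _)).
  rewrite /wt (_ : [set i | ev v ord0 i != 0] = ~: [set i | ev v ord0 i == 0]).
    by rewrite cardsC card_ord.
  by apply/setP=> i; rewrite !inE.
have hn := n_gt.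
split=> //.
(* The recovery set is the rest of the orbit. If two codewords agree there, the parity check of
   their difference has a single term left, with nonzero weight. *)
- move=> i; exists ([set idx ((unidx i).1, k) | k in ~: [set (unidx i).2]]).
  have inj : injective (fun k => idx ((unidx i).1, k)).
    by move=> k k' /(can_inj idxK) [].
  split.
  + apply/imsetP=> -[k]; rewrite !inE => kn e; move: kn.
    by rewrite {1}[in (unidx _).2]e idxK eqxx.
  + by rewrite card_imset // cardsC1 card_ord addn1.
  move=> c c' /CP[v ->] /CP[v' ->] ne.
  apply/exists_inP; apply: contraNT ne; rewrite negb_exists_in => /forall_inP eqI.
  rewrite -subr_eq0; have := sum_block (v - v') (unidx i).1.
  rewrite (bigD1 (unidx i).2) //= big1 ?addr0 => [|k ki].
    rewrite -surjective_pairing unidxK linearB !mxE => /eqP.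
    by rewrite mulf_eq0 !expf_eq0 (negbTE xi_neq0) !andbF orbF.
  rewrite linearB mxE [(- ev v') _ _]mxE; apply/eqP; rewrite mulf_eq0 subr_eq0.
  apply/orP; left; rewrite -[_ == _]negbK; apply: eqI.
  by apply/imsetP; exists k; rewrite // !inE.
- by move: dC hn; clear; lia.
have rt : (r * t = r * t.-1 + r)%N by rewrite -mulnSr prednK.
have r3 : (2 < r)%N by move: r_h h_gt1; clear; lia.
(* The dimension is r(t-1)+1, just above a multiple of r, so the rounded-up quotient is t. *)
have ct : ceil_div (r * t - (r - 1)) r = t.
  rewrite /ceil_div -subn1 subnK ?mulKn //; first by move: r3; clear; lia.
  by rewrite rt; move: (r * t.-1)%N => u; clear; lia.
have nE : ((t - 1) * (r + 1) = r * t.-1 + t.-1)%N by rewrite subn1 mulnC mulnDl mul1n.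
rewrite /lrc_defect dimC ct; move: dC hn t_gt0; rewrite nE rt.
by move: (r * t.-1)%N n (min_dist _) r3 => u N d; clear; lia.
Qed.

End CurveCode.

(** * From abscissae to codes, and the choice of curve *)

(** Abscissae with distinct h-th powers lie in distinct orbits, and at most h of them share one h-th
    power; hence l h abscissae provide l repair groups. *)
Lemma lrc_of_abscissae (F : finFieldType) (h r t l : nat) (f : {poly F}) :
  1 < h -> r + 1 = 2 * h -> 2 * h %| #|F|.-1 -> size f = 6 ->
  (forall xi z : F, (xi ^+ (2 * h) = 1 -> f.[xi ^+ 2 * z] = xi ^+ 10 * f.[z])%R) ->
  l * h <= #|curve_abscissae f| -> 0 < t -> t <= l ->
  exists C : {vspace 'rV[F]_(l * (r + 1))},
    [/\ \dim C = r * t - (r - 1),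
        has_locality C r,
        ((l * (r + 1))%:Z - ((t - 1) * (r + 1))%:Z - 1 <= (min_dist C)%:Z)%R &
        (lrc_defect (l * (r + 1)) (\dim C) (min_dist C) r <= 1)%R].
Proof.
move=> h1 rh hF sf fe lX t0 tl; have h0 := ltnW h1.
have [xi xiP] := finField_prim_root_dvd hF.
set X := curve_abscissae f in lX.
have X0 : 0%R \notin X by rewrite inE eqxx.
pose Z := [set (x ^+ h)%R | x in X].
have lZ : l <= #|Z|.
  by rewrite -(leq_pmul2r h0) (leq_trans lX) // mulnC card_le_imset_expr.
have /fin_all_exists[w wP] : forall j : 'I_l, exists w : F * F,
    [/\ w.1 != 0, w.2 != 0, w.2 ^+ 2 = f.[w.1] & w.1 ^+ h = nth 0 (enum Z) j]%R.
  move=> j.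
  have : nth 0%R (enum Z) j \in Z by rewrite -mem_enum mem_nth // -cardE (leq_trans (ltn_ord j)).
  case/imsetP=> x; rewrite inE => /and3P[x0 fx0 /existsP[y /eqP yx]] ->.
  exists (x, y); split=> //=.
  by apply: contraNneq fx0 => y0; rewrite -yx y0 expr0n.
apply: (@lrc_of_curve F h r t l xi f (fun j => (w j).1) (fun j => (w j).2)) => //.
- by move=> z; apply: fe; apply: prim_expr_order.
- by move=> j; case: (wP j).
- by move=> j; case: (wP j).
- by move=> j; case: (wP j).
move=> i j /=; case: (wP i) => _ _ _ ->; case: (wP j) => _ _ _ -> /eqP.
rewrite nth_uniq ?enum_uniq // -?cardE ?(leq_trans (ltn_ord _)) // => /eqP.
exact: val_inj.
Qed.

Theorem mainTheorem6 (p a r : nat) :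
  prime p -> odd p -> 0 < a -> odd a ->
  ((r \in [:: 3; 7]) && ((p %% 8 == 5) || (p %% 8 == 7)) \/
   (r == 9) && (p %% 5 == 4)) ->
  forall (F : finFieldType), #|F| = p ^ (2 * a) ->
  forall t l : nat,
    1 <= t -> t <= l ->
    l <= (p ^ (2 * a) + 4 * p ^ a - (2 * r + 3)) %/ (r + 1) ->
    exists C : {vspace 'rV[F]_(l * (r + 1))},
      [/\ \dim C = r * t - (r - 1),
          has_locality C r,
          ((l * (r + 1))%:Z - ((t - 1) * (r + 1))%:Z - 1 <= (min_dist C)%:Z)%R &
          (lrc_defect (l * (r + 1)) (\dim C) (min_dist C) r <= 1)%R].
Proof.
move=> p_pr p_odd a0 a_odd rp F cardF t l t0 tl.
rewrite leq_divRL ?addn1 // -addn1.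
have pF := card_finPcharP cardF p_pr.
rewrite [in X in _ <= X](mulnC 2 a) expnM; rewrite (mulnC 2 a) expnM in cardF.
have sF : [pchar F]%R.-nat (p ^ a) by rewrite pnatX pnatE // pF.
have s1 : 1 < p ^ a by rewrite -(exp1n a) ltn_exp2r // prime_gt1.
(* For odd a, p^a is p times a power of p^2; this carries the congruence on p over to s. *)
have smod m : p ^ 2 = 1 %[mod m] -> p ^ a = p %[mod m].
  move=> pm; rewrite -(odd_double_half a) a_odd expnD -mul2n expnM.
  by rewrite -modnMmr -modnXm pm modnXm exp1n modnMmr muln1.
have s_odd : odd (p ^ a) by rewrite oddX p_odd orbT.
move: (p ^ a) cardF sF s1 smod s_odd => s cardF sF s1 smod s_odd lb.
have Fs : #|F|.-1 = s.-1 * s.+1 by rewrite cardF; case: (s) => // u; clear; nia.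
case: rp => [/andP[r37 p8]|/andP[/eqP r9 p5]]; last first.
  have s5 : s %% 5 = 4.
    rewrite (smod 5); first exact/eqP.
    by rewrite -modnXm (eqP p5).
  have [k sk] : exists k, s.+1 = 10 * k by exists (s.+1 %/ 10); move: s5 s_odd; clear; lia.
  apply: (@lrc_of_abscissae F 5 r t l (1 - 'X^5)%R) => //.
  - by rewrite r9.
  - by rewrite Fs sk dvdn_mull // dvdn_mulr.
  - by rewrite addrC size_polyDl size_polyN size_polyXn // size_poly1.
  - move=> xi z xi10; rewrite !hornerE exprMn -exprM.
    by rewrite xi10 !mul1r.
  have := card_abscissae_1_minus_x5 cardF sF s1 sk.
  by move: lb; rewrite r9; move: (#|_|) (s ^ 2 + 4 * s) => X N; clear; lia.
have s8 : s %% 8 = p %% 8.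
  by apply: smod; rewrite -modnXm; case/orP: p8 => /eqP->.
have F8 : 8 %| #|F|.-1.
  move: p8; rewrite Fs -s8 => /orP[|] s8'.
    have -> : s.-1 = 4 * (s.-1 %/ 4) by move: s8'; clear; lia.
    have -> : s.+1 = 2 * (s.+1 %/ 2) by move: s8'; clear; lia.
    by rewrite mulnACA dvdn_mulr.
  have -> : s.+1 = 8 * (s.+1 %/ 8) by move: s8'; clear; lia.
  by rewrite dvdn_mull ?dvdn_mulr.
have cX : s ^ 2 + 4 * s <= 2 * #|curve_abscissae ('X^5 + 'X : {poly F})%R| + 5.
  rewrite -s8 in p8; case/orP: p8 => s8'.
    apply: (@card_abscissae_x5_plus_x_5mod8 F s cardF sF s1 (s %/ 8)).
    by move: s8'; clear; lia.
  apply: (@card_abscissae_x5_plus_x_7mod8 F s cardF sF s1 (s.+1 %/ 8)).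
  by move: s8'; clear; lia.
(* For h = 2 and h = 4 alike xi^8 = 1, so xi^10 = xi^2 and both terms of x^5 + x scale by the same
   factor. *)
have [h [h1 h8 rh]] : exists h, [/\ 1 < h, 2 * h %| 8 & r + 1 = 2 * h].
  by move: r37; rewrite !inE => /orP[]/eqP->; [exists 2|exists 4].
apply: (@lrc_of_abscissae F h r t l ('X^5 + 'X)%R) => //.
- exact: dvdn_trans h8 F8.
- by rewrite size_polyDl ?size_polyXn // size_polyX.
- move=> xi z xih; rewrite !hornerE.
  have xi8 : (xi ^+ 8 = 1)%R by case/dvdnP: h8 => c ->; rewrite mulnC exprM xih expr1n.
  by rewrite exprMn -exprM mulrDr (exprD xi 8 2) xi8 mul1r.
by move: lb cX h1; rewrite rh; move: (#|_|) (s ^ 2 + 4 * s) => X N; clear -rh; nia.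
Qed.
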